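(* Let $k\in\mathbb Z$, let $n\geq 0$ be an integer, and let $z\in\mathbb C\setminus\mathbb R$. If $k$ is odd, then $g_k(n,z)=0$. For even weights, $g_{2k}(n,z)$ (with $k\in\mathbb Z$ arbitrary) satisfies: (i) $g_{2k}\left(n,-\frac1z\right)=z^{2k}\,g_{2k}(n,z)$; (ii) $g_{2k}(n,-z)=g_{2k}(n,z)$.
   Context: A partition $\lambda=(\lambda_1,\lambda_2,\dots,\lambda_r)$ is a finite sequence of integers with $\lambda_1\geq\lambda_2\geq\dots\geq\lambda_r\geq 1$; $r\geq 0$ is its length, and the empty partition $\emptyset$ (with $r=0$) is allowed. The size of $\lambda$ is $|\lambda|=\lambda_1+\dots+\lambda_r$, and $\lambda\vdash n$ means that $\lambda$ is a partition with $|\lambda|=n$ (so $\emptyset\vdash 0$). For $z\in\mathbb C\setminus\mathbb R$, the Ferrers-Young lattice of $\lambda$ is the finite set of complex numbers $$\mathscr F(\lambda,z)=\{az+b:\ a,b\in\mathbb Z,\ 1\leq|b|\leq r,\ 1\leq|a|\leq\lambda_{|b|}\}.$$ For $k\in\mathbb Z$, the single-partition Eisenstein series is $$f_k(\lambda,z)=\frac14\sum_{\omega\in\mathscr F(\lambda,z)}\omega^{-k},\qquad f_k(\emptyset,z)=0,$$ and the partition Eisenstein series is, for $n\geq1$, $$g_k(n,z)=\sum_{\lambda\vdash n}f_k(\lambda,z),\qquad\text{with } g_k(0,z)=0.$$ *)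

(* Defs.v *)
(* The complex numbers are R[i], for R : realType. *)
From HB Require Import structures.
From mathcomp Require Import all_boot all_order all_algebra.
From mathcomp Require Import all_classical reals.
From mathcomp Require Export complex.

Set Implicit Arguments.
Unset Strict Implicit.
Unset Printing Implicit Defensive.

Import Order.TTheory GRing.Theory Num.Theory.
Local Open Scope classical_set_scope.
Local Open Scope ring_scope.

Definition is_partition (lam : seq nat) : bool :=
  sorted geq lam && all (fun p => 1 <= p)%N lam.

Definition partitions (n : nat) : set (seq nat) :=
  [set lam | is_partition lam /\ sumn lam = n].

(* Parts are numbered from 1, as in lambda_1 >= lambda_2 >= ... *)
Definition part (lam : seq nat) (j : nat) : nat := nth 0%N lam j.-1.

Section Eisenstein.
Context {R : realType}.

Definition ferrers_young (lam : seq nat) (z : R[i]) : set R[i] :=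
  [set w | exists a b : int,
     [/\ (1 <= `|b| <= size lam)%N, (1 <= `|a| <= part lam `|b|)%N
       & w = a%:~R * z + b%:~R]].

(* The sum [\sum_(x \in A)] over a classical set is 0 by convention when
   infinitely many terms are nonzero; [finite_ferrers_young] and
   [finite_partitions] show that this never happens here. *)
Definition eisenstein_single (k : int) (lam : seq nat) (z : R[i]) : R[i] :=
  4^-1 * \sum_(w \in ferrers_young lam z) w ^ (- k).

Definition eisenstein (k : int) (n : nat) (z : R[i]) : R[i] :=
  \sum_(lam \in partitions n) eisenstein_single k lam z.

End Eisenstein.

Lemma finite_partitions n : finite_set (partitions n).
Proof.
pose F (m : nat) := range (fun t : m.-tuple 'I_n.+1 => map val t).
apply: (@sub_finite_set _ _ (\bigcup_(m in `I_n.+1) F m)); last first.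
  apply: bigcup_finite => [|m _]; first exact: finite_II.
  exact: finite_image.
move=> lam [/andP[_ pos] sz].
have le_sz : (size lam <= n)%N.
  rewrite -sz; elim: lam pos {sz} => //= p lam IH /andP[p0 /IH le_lam].
  by rewrite -add1n leq_add.
have le_n p : p \in lam -> (p <= n)%N.
  rewrite -sz; elim: lam {pos sz le_sz} => //= q lam IH.
  rewrite inE => /orP[/eqP->|/IH pl]; first exact: leq_addr.
  exact: (leq_trans pl (leq_addl _ _)).
exists (size lam) => //=.
exists (map_tuple inord (in_tuple lam)) => //=.
rewrite -map_comp -[RHS]map_id; apply/eq_in_map => p /le_n pn /=.
by rewrite inordK.
Qed.

Lemma finite_ferrers_young (R : realType) (lam : seq nat) (z : R[i]) :
  finite_set (ferrers_young lam z).
Proof.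
pose M := (size lam + sumn lam)%N.
have partM j : (part lam j <= M)%N.
  rewrite /part (leq_trans _ (leq_addl _ _)) //.
  elim: lam (j.-1) {M} => [|p lam IH] [|i] //=; first exact: leq_addr.
  exact: (leq_trans (IH i) (leq_addl _ _)).
pose toint (p : bool * 'I_M.+1) : int := (-1) ^+ p.1 * p.2%:Z.
pose g (p : (bool * 'I_M.+1) * (bool * 'I_M.+1)) : R[i] :=
  (toint p.1)%:~R * z + (toint p.2)%:~R.
apply: (@sub_finite_set _ _ (range g)); last exact: finite_image.
have tointP (a : int) : (`|a| <= M)%N -> exists p, toint p = a.
  by move=> aM; exists (a < 0, inord `|a|); rewrite /toint /= inordK // abszE -numEsign.
move=> w [a [b [/andP[_ hb] /andP[_ ha] ->]]].
have [p pa] := tointP a (leq_trans ha (partM _)).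
have [q qb] := tointP b (leq_trans hb (leq_addr _ _)).
by exists (p, q) => //; rewrite /g /= pa qb.
Qed.

Lemma eisenstein_single0 (R : realType) (k : int) (z : R[i]) :
  eisenstein_single k [::] z = 0.
Proof.
rewrite /eisenstein_single (_ : ferrers_young _ _ = set0) ?fsbig_set0 ?mulr0 //.
by apply/seteqP; split=> // w [a [b [/andP[b0]]]]; rewrite leqNgt b0.
Qed.

Lemma eisenstein0 (R : realType) (k : int) (z : R[i]) : eisenstein k 0 z = 0.
Proof.
rewrite /eisenstein (_ : partitions 0 = [set [::]]).
  by rewrite fsbig_set1 eisenstein_single0.
apply/seteqP; split=> [[|p lam] [/andP[_ pos] /=]|_ ->] //=.
by move: pos => /= /andP[]; case: p.
Qed.

(* Main.v *)
Require Import Defs.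
From mathcomp Require Import all_boot all_order all_algebra.
From mathcomp Require Import all_classical reals.
From mathcomp Require Import zify ring.

(** Everything follows from symmetries of the lattices, together with the
    homogeneity of the single-partition series: if the lattice of [mu] at [z'] is
    [c] times the lattice of [lam] at [z], then the series of [mu] at [z'] is
    [c ^ (- k)] times that of [lam] at [z] ([eisenstein_single_scale]).

    The conditions defining a lattice see only [`|a|] and [`|b|].  Hence each
    lattice is invariant under [w |-> - w], so that for odd [k] every
    single-partition series is its own opposite, and the lattice at [- z] is the
    lattice at [z].

    Inversion is the only case that mixes partitions.  The pairs
    [(`|b|, `|a|)] run over the cells (row, column) of the Young diagram of
    [lam], and [a * (- 1 / z) + b = z^-1 * (b * z - a)]: the roles of [a] and [b]
    are exchanged, which transposes the diagram.  So the lattice of [lam] at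
    [- 1 / z] is [z^-1] times the lattice at [z] of the conjugate partition
    ([ferrers_young_inv]).  Conjugation is an involution on the partitions of
    [n], so summing over all of them gives the transformation law. *)

Set Implicit Arguments.
Unset Strict Implicit.
Unset Printing Implicit Defensive.

Import Order.TTheory GRing.Theory Num.Theory.
Local Open Scope classical_set_scope.
Local Open Scope ring_scope.

(** * Conjugate partitions *)

Definition conjugate (lam : seq nat) : seq nat :=
  mkseq (fun i => count (fun p => i < p)%N lam) (head 0%N lam).

Lemma partition_cons p lam : is_partition (p :: lam) ->
  [/\ (0 < p)%N, all (geq p) lam & is_partition lam].
Proof.
move=> /andP[/= srt /andP[p0 pos]]; split=> //.
  by apply: order_path_min srt => a b c /= ba cb; exact: leq_trans cb ba.
by rewrite /is_partition pos (path_sorted srt).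
Qed.

Lemma partition_le_head lam : is_partition lam -> all (geq (head 0%N lam)) lam.
Proof. by case: lam => //= p lam /partition_cons[_ -> _]; rewrite leqnn. Qed.

(** The parts greater than [i] come first, since the parts decrease. *)
Lemma ltn_count_partition lam i j : is_partition lam ->
  (j < count (fun p => i < p)%N lam)%N = (i < nth 0%N lam j)%N.
Proof.
elim: lam j => [|p lam IH] j; first by rewrite nth_nil.
move=> /partition_cons[_ /allP le_p /IH {}IH] /=.
case: (ltnP i p) => [ip|pi]; first by case: j => [|j] //=; rewrite add1n ltnS IH.
have -> : count (fun q => i < q)%N lam = 0%N.
  apply/eqP; rewrite -leqn0 leqNgt -has_count; apply/hasPn => q /le_p /= qp.
  by rewrite -leqNgt (leq_trans qp).
rewrite addn0 ltn0; apply/esym; apply/negbTE; rewrite -leqNgt.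
case: j => [|j] //=; case: (ltnP j (size lam)) => [jl|lj].
  by rewrite (leq_trans _ pi) //; exact: le_p (mem_nth _ jl).
by rewrite nth_default.
Qed.

(** Conjugation transposes diagrams.  Since [head 0 lam] is the largest part, no
    part exceeds an [i] beyond the length of [conjugate lam]. *)
Lemma ltn_nth_conjugate lam i j : is_partition lam ->
  (j < nth 0%N (conjugate lam) i)%N = (i < nth 0%N lam j)%N.
Proof.
move=> Plam; rewrite -[RHS]ltn_count_partition //.
case: (ltnP i (head 0%N lam)) => [hi|hi]; first by rewrite nth_mkseq.
rewrite nth_default ?size_mkseq // [count _ _](_ : _ = 0%N) //.
apply/eqP; rewrite -leqn0 leqNgt -has_count; apply/hasPn => q qlam.
by rewrite -leqNgt (leq_trans _ hi) //; exact: (allP (partition_le_head Plam)).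
Qed.

Lemma conjugate_is_partition lam : is_partition lam -> is_partition (conjugate lam).
Proof.
move=> Plam; apply/andP; split.
  apply: homo_sorted (iota_sorted 0 _) => i j ij /=.
  by apply: sub_count => p; exact: leq_ltn_trans.
rewrite all_map; apply/allP => i; rewrite mem_iota /= add0n => hi.
by rewrite ltn_count_partition // nth0.
Qed.

(** Count the cells in two ways: the part [p] contributes its cells in the columns
    [i < p], and all columns are below [head 0 lam]. *)
Lemma sumn_conjugate lam : is_partition lam -> sumn (conjugate lam) = sumn lam.
Proof.
move=> Plam; rewrite !sumnE big_map.
under eq_bigr => i _ do rewrite -sum1_count big_mkcond.
rewrite exchange_big /=; apply: eq_big_seq => p plam.
have ple := allP (partition_le_head Plam) _ plam.
have low : count (fun i => i < p)%N (iota 0 p) = p.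
  apply/eqP; rewrite -[X in _ == X](size_iota 0) -all_count.
  by apply/allP => i; rewrite mem_iota add0n.
have high m : count (fun i => i < p)%N (iota p m) = 0%N.
  apply/eqP; rewrite -leqn0 leqNgt -has_count; apply/hasPn => i.
  by rewrite mem_iota -leqNgt => /andP[].
rewrite -big_mkcond sum1_count -[X in iota 0 X](subnKC ple) iotaD count_cat add0n.
by rewrite low high addn0.
Qed.

(** The parts being positive, the nonempty rows of the diagram give the length. *)
Lemma partition_ext lam mu : is_partition lam -> is_partition mu ->
  (forall i j, (j < nth 0%N lam i)%N = (j < nth 0%N mu i)%N) -> lam = mu.
Proof.
have lt_size nu i : is_partition nu -> (i < size nu)%N = (0 < nth 0%N nu i)%N.
  move=> /andP[_ /allP pos]; case: (ltnP i (size nu)) => hi.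
    by rewrite pos ?mem_nth.
  by rewrite nth_default.
move=> Plam Pmu cells.
have eq_lt (x y : nat) : (forall j, (j < x)%N = (j < y)%N) -> x = y.
  move=> xy; apply/eqP; rewrite eqn_leq (leqNgt x) (leqNgt y).
  by rewrite xy -[X in _ && ~~ X]xy !ltnn.
apply: (@eq_from_nth _ 0%N) => [|i _]; apply: eq_lt => j; last exact: cells.
by rewrite !lt_size.
Qed.

Lemma conjugateK lam : is_partition lam -> conjugate (conjugate lam) = lam.
Proof.
move=> Plam; have Pc := conjugate_is_partition Plam.
apply: partition_ext => // [|i j]; first exact: conjugate_is_partition.
by rewrite !ltn_nth_conjugate.
Qed.

Lemma conjugate_bij n : set_bij (partitions n) (partitions n) conjugate.
Proof.
have conj_n lam : partitions n lam -> partitions n (conjugate lam).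
  by case=> Plam <-; split; [exact: conjugate_is_partition|exact: sumn_conjugate].
split=> [lam /= /conj_n //|lam mu|lam [Plam lam_n]].
  by rewrite !inE => -[Plam _] [Pmu _] eq_c; rewrite -(conjugateK Plam) eq_c conjugateK.
by exists (conjugate lam); [exact: conj_n|exact: conjugateK].
Qed.

(** * Symmetries of Ferrers-Young lattices *)

(** Membership in terms of cells, with rows and columns counted from 0: as
    [nth 0 lam] vanishes from [size lam] on, a row with a cell in column [`|a|.-1]
    is a row of [lam].  In this form exchanging [a] and [b] amounts to transposing
    the diagram. *)
Lemma ferrers_youngP (R : realType) lam (z w : R[i]) :
  ferrers_young lam z w <->
  exists a b : int, [/\ (0 < `|b|)%N, (0 < `|a|)%N,
    (`|a|.-1 < nth 0%N lam `|b|.-1)%N & w = a%:~R * z + b%:~R].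
Proof.
split=> -[a [b]].
  case=> /andP[b0 _] /andP[a0 ab] ->; exists a, b; split=> //.
  by rewrite prednK.
case=> b0 a0 ab ->; exists a, b; split=> //; last by rewrite a0 -[`|a|%N]prednK.
rewrite b0 /= -[`|b|%N]prednK //; case: (ltnP `|b|.-1 (size lam)) => // hb.
by rewrite nth_default in ab.
Qed.

Lemma ferrers_youngN (R : realType) lam (z : R[i]) :
  ferrers_young lam (- z) = ferrers_young lam z.
Proof.
have sub (y : R[i]) : ferrers_young lam (- y) `<=` ferrers_young lam y.
  by move=> w [a [b [hb ha ->]]]; exists (- a), b; rewrite abszN mulrN rmorphN mulNr.
by apply/seteqP; split; first exact: sub; rewrite -[X in ferrers_young _ X]opprK.
Qed.

Lemma ferrers_young_opp (R : realType) lam (z : R[i]) :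
  ferrers_young lam z = [set -1 * w | w in ferrers_young lam z].
Proof.
have opp w : ferrers_young lam z w -> ferrers_young lam z (- w).
  move=> [a [b [hb ha ->]]]; exists (- a), (- b).
  by rewrite !abszN opprD !rmorphN mulNr.
apply/seteqP; split=> [w /opp Fw|_ [w /opp Fw <-]]; last by rewrite mulN1r.
by exists (- w); rewrite // mulN1r opprK.
Qed.

(** [a * (- 1 / z) + b = z^-1 * (b * z - a)]: the coefficients exchange their
    roles, that is, rows and columns of the diagram are exchanged. *)
Lemma ferrers_young_inv (R : realType) lam (z : R[i]) :
  is_partition lam -> z != 0 ->
  ferrers_young lam (- 1 / z) =
    [set z^-1 * w | w in ferrers_young (conjugate lam) z].
Proof.
move=> Plam z0; apply/seteqP; split=> [w|_ [w] + <-] => /ferrers_youngP[a [b]].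
  case=> b0 a0 ab ->; exists (b%:~R * z - a%:~R); last by field.
  apply/ferrers_youngP; exists b, (- a).
  by rewrite abszN ltn_nth_conjugate // rmorphN.
case=> b0 a0 ab ->; apply/ferrers_youngP; exists (- b), a.
rewrite abszN -ltn_nth_conjugate //; split=> //.
by rewrite rmorphN /=; field.
Qed.

(** * Transformation laws *)

Lemma eisenstein_single_scale (R : realType) (k : int) lam mu (z z' c : R[i]) :
  c != 0 -> ferrers_young mu z' = [set c * w | w in ferrers_young lam z] ->
  eisenstein_single k mu z' = c ^ (- k) * eisenstein_single k lam z.
Proof.
rewrite /eisenstein_single => c0 ->; rewrite fsbig_image.
  rewrite mulrCA; congr (_ * _); rewrite mulr_fsumr.
  by apply: eq_fsbigr => w _; rewrite expfzMl.
by move=> x y _ _; exact: mulfI.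
Qed.

(** Scaling the lattice by [-1] leaves it unchanged and multiplies the series by
    [(-1) ^ (- k) = -1]. *)
Lemma eisenstein_odd (R : realType) (k : int) n (z : R[i]) :
  ~~ (2 %| k)%Z -> eisenstein k n z = 0.
Proof.
move=> k_odd; rewrite /eisenstein fsbig1 // => lam _.
have signN1 : (-1 : R[i]) ^ (- k) = -1.
  have [m ->] : exists m, - k = 2 * m + 1.
    (* For odd [k = 2 * q + 1], [- k = 2 * (- (q + 1)) + 1]. *)
    exists (- ((k %/ 2)%Z + 1)).
    have := divz_eq k 2; have := modz_ge0 k (isT : 2%:Z != 0).
    have := ltz_pmod k (isT : 0 < 2%:Z :> int); move: k_odd => /dvdz_mod0P; lia.
  rewrite expfzDr ?oppr_eq0 ?oner_eq0 // expr1z -exprz_exp -exprnP sqrrN.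
  by rewrite expr1n exp1rz mul1r.
have := eisenstein_single_scale k _ (ferrers_young_opp lam z).
rewrite oppr_eq0 oner_eq0 signN1 mulN1r => /(_ isT) /eqP.
by rewrite -addr_eq0 -mulr2n mulrn_eq0 => /eqP.
Qed.

Lemma eisenstein_opp (R : realType) (k : int) n (z : R[i]) :
  eisenstein k n (- z) = eisenstein k n z.
Proof.
by apply: eq_fsbigr => lam _; rewrite /eisenstein_single ferrers_youngN.
Qed.

Lemma eisenstein_inv (R : realType) (k : int) n (z : R[i]) : z != 0 ->
  eisenstein k n (- 1 / z) = z ^ k * eisenstein k n z.
Proof.
move=> z0; rewrite /eisenstein mulr_fsumr [RHS](reindex_fsbig _ _ _ _ (conjugate_bij n)).
apply: eq_fsbigr => lam; rewrite inE => -[Plam _].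
rewrite (eisenstein_single_scale k _ (ferrers_young_inv Plam z0)) ?invr_eq0 //.
by rewrite exprz_inv opprK.
Qed.

Theorem theorem1 (R : realType) (k : int) (n : nat) (z : R[i])
    (hz : z \isn't Num.real) :
  (~~ (2 %| k)%Z -> eisenstein k n z = 0) /\
  eisenstein (2 * k) n (- 1 / z) = z ^ (2 * k) * eisenstein (2 * k) n z /\
  eisenstein (2 * k) n (- z) = eisenstein (2 * k) n z.
Proof.
have z0 : z != 0 by apply: contraNneq hz => ->; exact: real0.
by split; [exact: eisenstein_odd|split; [exact: eisenstein_inv|exact: eisenstein_opp]].
Qed.
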